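(* Let $(M,g)$ be a semi-Riemannian manifold of dimension $n\ge3$ satisfying $P\cdot\mathcal R=L\,Q(S,\mathcal R)$ for some $L\in C^\infty(M)$. Then: (i) $R\cdot R=0$ if $L+\frac{1}{n-1}=0$. (ii) $P\cdot S=R\cdot S=0$, i.e. $M$ is Ricci semisymmetric, and thus $E=S^2$. (iii) $n^2S^2-2n\kappa S+\kappa^2g=0$ and $\kappa^{(2)}=\frac{\kappa^2}{n}$ if $L+\frac{1}{n-1}\ne0$. (iv) $S\wedge S=g\wedge S^2$, and $S^2=\frac{\kappa}{n}S=\frac{\kappa^{(2)}}{n}g$. Moreover, if $\kappa\ne0$, then $M$ is Einstein. (v) For $L+\frac{1}{n-1}\ne0$, $P\cdot\mathcal S=L\,Q(g,\mathcal S)$ if and only if $$R(Y,X_1,X_2,\mathcal SX)+R(Y,X_2,X_1,\mathcal SX)-R(X,X_1,X_2,\mathcal SY)-R(X,X_2,X_1,\mathcal SY)=0$$ for all vector fields $X_1,X_2,X,Y$.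
   Context: $(M,g)$ is a connected smooth semi-Riemannian manifold of dimension $n\ge 3$; $R$ is the $(0,4)$ Riemann curvature tensor and $\mathcal R$ the $(1,3)$ one, $g(\mathcal R(X,Y)X_1,X_2)=R(X,Y,X_1,X_2)$, with the sign convention that the Ricci tensor $S(X_2,X_3)$ is the $g$-trace of $R(X_1,X_2,X_3,X_4)$ over $X_1,X_4$; $\kappa$ is the scalar curvature; $\mathcal S$ is the Ricci operator, $g(\mathcal SX,Y)=S(X,Y)$, $S^2(X,Y)=g(\mathcal S^2X,Y)$, $\kappa^{(2)}=\mathrm{trace}(\mathcal S^2)$. $E(X,Y)$ is the $(0,2)$-tensor obtained by contracting $R(X_1,X,Y,\mathcal SX_2)$ over $X_1,X_2$. Einstein means $S=\frac{\kappa}{n}g$. Projective curvature tensor: $P(X_1,X_2,X_3,X_4)=R(X_1,X_2,X_3,X_4)-\frac{1}{n-1}\left[S(X_2,X_3)g(X_1,X_4)-S(X_1,X_3)g(X_2,X_4)\right]$. An endomorphism $\mathscr L$ of vector fields acts on a $(0,k)$-tensor $H$ by $(\mathscr LH)(X_1,\dots,X_k)=-\sum_iH(X_1,\dots,\mathscr LX_i,\dots,X_k)$ and on a $(1,k-1)$-tensor $\mathcal H$ by $(\mathscr L\mathcal H)(X_1,\dots,X_{k-1})=\mathscr L(\mathcal H(X_1,\dots,X_{k-1}))-\sum_i\mathcal H(X_1,\dots,\mathscr LX_i,\dots,X_{k-1})$. For a $(0,4)$-tensor $D$ with associated $(1,3)$-tensor $\mathcal D$ ($g(\mathcal D(X,Y)X_1,X_2)=D(X,Y,X_1,X_2)$),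 $D\cdot H$ and $D\cdot\mathcal H$ are obtained with $\mathscr L=\mathcal D(X,Y)$ ($X,Y$ placed as last arguments); for a symmetric $(0,2)$-tensor $A$, $Q(A,H)$ and $Q(A,\mathcal H)$ are obtained with $\mathscr L=X\wedge_AY$, $(X\wedge_AY)Z=A(Y,Z)X-A(X,Z)Y$. Kulkarni–Nomizu product: $(A\wedge F)(X_1,X_2,X_3,X_4)=A(X_1,X_4)F(X_2,X_3)+A(X_2,X_3)F(X_1,X_4)-A(X_1,X_3)F(X_2,X_4)-A(X_2,X_4)F(X_1,X_3)$.
   Formalization: Part (iv) is proved under the added condition L+1/(n-1)≠0 (read pointwise, as in (iii) and (v)); without it (iv) is false, e.g. for S^2×R with n=3 and L=-1/2, where S^2=S, κ=2 and M is not Einstein. *)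

(* Defs.v *)
From HB Require Import structures.
From mathcomp Require Import all_boot all_order all_algebra.
From mathcomp Require Import all_classical all_reals all_analysis.

Set Implicit Arguments.
Unset Strict Implicit.
Unset Printing Implicit Defensive.

Import Order.TTheory GRing.Theory Num.Theory.
Import numFieldNormedType.Exports.
Local Open Scope classical_set_scope.
Local Open Scope ring_scope.

(* In a chart, the tangent space at a point is 'rV[R]_n with the coordinate   *)
(* frame 'e_a = delta_mx 0 a.  A (0,k)-tensor at a point is a function        *)
(* ('I_k -> 'rV[R]_n) -> R and a (1,k)-tensor a function                      *)
(* ('I_k -> 'rV[R]_n) -> 'rV[R]_n.                                            *)

Section Smooth.
Variables (R : realType) (n : nat).
Implicit Types (U : set 'rV[R]_n) (f : 'rV[R]_n -> R).

Definition pder (a : 'I_n) f : 'rV[R]_n -> R := 'D_(delta_mx 0 a) f.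

(* Meant for open U: all iterated partial derivatives of order at most k      *)
(* exist and are continuous at every point of U.                              *)
Fixpoint Ck (k : nat) U f : Prop :=
  (forall x, U x -> {for x, continuous f}) /\
  (if k is k'.+1 then
     forall a : 'I_n, (forall x, U x -> derivable f x (delta_mx 0 a)) /\
                      Ck k' U (pder a f)
   else True).

Definition smooth_on U f : Prop := forall k, Ck k U f.

End Smooth.

(* A smooth manifold is given by an atlas, not necessarily maximal.           *)
(* chart_inv is only meaningful on the image of the chart.                    *)
Record smooth_manifold (R : realType) (n : nat) := SmoothManifold {
  space :> topologicalType;
  space_hausdorff : hausdorff_space space;
  space_second_countable : @second_countable space;
  atlas : Type;
  dom : atlas -> set space;
  chart : atlas -> space -> 'rV[R]_n;
  chart_inv : atlas -> 'rV[R]_n -> space;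
  atlas_cover : forall p : space, exists i, dom i p;
  dom_open : forall i, open (dom i);
  chart_image_open : forall i, open (chart i @` dom i);
  chartK : forall i p, dom i p -> chart_inv i (chart i p) = p;
  chart_continuous : forall i, {within dom i, continuous (chart i)};
  chart_inv_continuous :
    forall i, {within chart i @` dom i, continuous (chart_inv i)};
  transition_smooth : forall i j (a : 'I_n),
    smooth_on (chart i @` (dom i `&` dom j))
              (fun x => chart j (chart_inv i x) 0 a)
}.

Arguments atlas {R n} _.
Arguments dom {R n _} i.
Arguments chart {R n _} i _.
Arguments chart_inv {R n _} i _.

Definition smooth_fun (R : realType) (n : nat) (M : smooth_manifold R n)
    (f : M -> R) : Prop :=
  forall i : atlas M, smooth_on (chart i @` dom i) (f \o chart_inv i).

(* gmat i x is the Gram matrix, at the point of coordinates x, of the         *)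
(* coordinate frame of the chart i; the signature is arbitrary.  Vectors are  *)
(* rows, so a vector u in the chart i becomes u *m 'J t x in the chart j.     *)
Record semi_riemannian_metric (R : realType) (n : nat)
    (M : smooth_manifold R n) := SemiRiemannianMetric {
  gmat : atlas M -> 'rV[R]_n -> 'M[R]_n;
  gmat_sym : forall i x, (chart i @` dom i) x -> (gmat i x)^T = gmat i x;
  gmat_nondegenerate :
    forall i x, (chart i @` dom i) x -> gmat i x \in unitmx;
  gmat_smooth : forall i (a b : 'I_n),
    smooth_on (chart i @` dom i) (fun x => gmat i x a b);
  gmat_transition : forall i j x, (chart i @` (dom i `&` dom j)) x ->
    let t := chart j \o chart_inv i in
    gmat i x = jacobian t x *m gmat j (t x) *m (jacobian t x)^T
}.

Section Coordinates.
Variables (R : realType) (n : nat) (G : 'rV[R]_n -> 'M[R]_n).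

(* christoffel c a b x is the coefficient of 'e_c in nabla_('e_a) 'e_b for    *)
(* the Levi-Civita connection of the metric G.                                *)
Definition christoffel (c a b : 'I_n) (x : 'rV[R]_n) : R :=
  2^-1 * \sum_d invmx (G x) c d *
    (pder a (fun y => G y b d) x + pder b (fun y => G y a d) x
     - pder d (fun y => G y a b) x).

(* The coefficient of 'e_d in                                                 *)
(* nabla_('e_a) nabla_('e_b) 'e_c - nabla_('e_b) nabla_('e_a) 'e_c.           *)
Definition curvature_coef (a b c d : 'I_n) (x : 'rV[R]_n) : R :=
  pder a (christoffel d b c) x - pder b (christoffel d a c) x
  + \sum_m (christoffel m b c x * christoffel d a m x
            - christoffel m a c x * christoffel d b m x).

End Coordinates.

Section MultilinearAlgebra.
Variables (R : realType) (n : nat).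
Local Notation E := 'rV[R]_n.
Variable h : 'M[R]_n.

Definition form (X Y : E) : R := (X *m h *m Y^T) 0 0.

(* The vector representing a linear form w: form (sharp w) Y = w Y.           *)
Definition sharp (w : E -> R) : E :=
  \row_b \sum_a w (delta_mx 0 a) * invmx h a b.

Definition contraction (B : E -> E -> R) : R :=
  \sum_a \sum_b invmx h a b * B (delta_mx 0 a) (delta_mx 0 b).

Definition subst_at k (ell : E -> E) (X : 'I_k -> E) (i j : 'I_k) : E :=
  if j == i then ell (X j) else X j.

Definition act_cov k (ell : E -> E) (H : ('I_k -> E) -> R) :
    ('I_k -> E) -> R :=
  fun X => - \sum_(i < k) H (subst_at ell X i).

Definition act_vec k (ell : E -> E) (H : ('I_k -> E) -> E) :
    ('I_k -> E) -> E :=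
  fun X => ell (H X) - \sum_(i < k) H (subst_at ell X i).

Definition assoc13 (D : E -> E -> E -> E -> R) (X Y Z : E) : E :=
  sharp (D X Y Z).

Definition wedge_op (A : E -> E -> R) (X Y Z : E) : E :=
  A Y Z *: X - A X Z *: Y.

Definition dot_cov k (D : E -> E -> E -> E -> R) (H : ('I_k -> E) -> R)
    (Xs : 'I_k -> E) (X Y : E) : R := act_cov (assoc13 D X Y) H Xs.

Definition dot_vec k (D : E -> E -> E -> E -> R) (H : ('I_k -> E) -> E)
    (Xs : 'I_k -> E) (X Y : E) : E := act_vec (assoc13 D X Y) H Xs.

Definition Q_vec k (A : E -> E -> R) (H : ('I_k -> E) -> E)
    (Xs : 'I_k -> E) (X Y : E) : E := act_vec (wedge_op A X Y) H Xs.

Definition kulkarni_nomizu (A F : E -> E -> R) (X1 X2 X3 X4 : E) : R :=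
  A X1 X4 * F X2 X3 + A X2 X3 * F X1 X4
  - A X1 X3 * F X2 X4 - A X2 X4 * F X1 X3.

Definition cov2 (A : E -> E -> R) (X : 'I_2 -> E) : R := A (X 0) (X 1).
Definition cov4 (D : E -> E -> E -> E -> R) (X : 'I_4 -> E) : R :=
  D (X 0) (X 1) (X 2) (X 3).
Definition vec1 (A : E -> E) (X : 'I_1 -> E) : E := A (X 0).
Definition vec3 (D : E -> E -> E -> E) (X : 'I_3 -> E) : E :=
  D (X 0) (X 1) (X 2).

End MultilinearAlgebra.

(* The tensors of (M, g) at the point p, read in the chart i; meaningful when *)
(* p lies in dom i.                                                           *)
Section Geometry.
Variables (R : realType) (n : nat) (M : smooth_manifold R n).
Variables (g : semi_riemannian_metric M) (i : atlas M) (p : M).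
Local Notation E := 'rV[R]_n.

Definition gram : 'M[R]_n := gmat g i (chart i p).

Definition metric_at : E -> E -> R := form gram.

Definition Riem13 (X Y Z : E) : E :=
  \row_d \sum_a \sum_b \sum_c
    X 0 a * Y 0 b * Z 0 c * curvature_coef (gmat g i) a b c d (chart i p).

Definition Riem (X1 X2 X3 X4 : E) : R := metric_at (Riem13 X1 X2 X3) X4.

Definition Ric (X Y : E) : R :=
  contraction gram (fun X1 X2 => Riem X1 X Y X2).

Definition scal : R := contraction gram Ric.

Definition RicOp (X : E) : E := sharp gram (Ric X).

Definition Ric2 (X Y : E) : R := metric_at (RicOp (RicOp X)) Y.

(* lin1_mx f is the matrix of the linear map f. *)
Definition scal2 : R := \tr (lin1_mx (RicOp \o RicOp)).

Definition Etens (X Y : E) : R :=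
  contraction gram (fun X1 X2 => Riem X1 X Y (RicOp X2)).

Definition Proj (X1 X2 X3 X4 : E) : R :=
  Riem X1 X2 X3 X4
  - (n%:R - 1)^-1 * (Ric X2 X3 * metric_at X1 X4 - Ric X1 X3 * metric_at X2 X4).

Definition einstein_at : Prop :=
  forall X Y : E, Ric X Y = scal / n%:R * metric_at X Y.

End Geometry.

Definition einstein (R : realType) (n : nat) (M : smooth_manifold R n)
    (g : semi_riemannian_metric M) : Prop :=
  forall (i : atlas M) (p : M), dom i p -> einstein_at g i p.

(* Main.v *)
(* Everything happens at one point.  Since the operator of [P] is that of [R] *)
(* minus [1/(n-1)] times the wedge of [S], the hypothesis reads               *)
(* [R . R13 = lam Q(S, R13)] with [lam = L + 1/(n-1)].  If [lam = 0], then    *)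
(* [R . R = 0] and a trace gives [R . S = 0].  If [lam <> 0], then [Q(S, R)], *)
(* like [R . R], is skew in its last two arguments, that is, for a curvature  *)
(* operator [M = R(Z1, Z2)] and all [X], [Y], [Z], [W],                       *)
(*   S(Y,MZ) g(X,W) - S(X,MZ) g(Y,W) - S(Y,Z) g(MX,W) + S(X,Z) g(MY,W)        *)
(* is skew in [Z], [W].  Contracting [X] with [W], and comparing with the     *)
(* transpose, shows that [M] commutes with the Ricci operator [A] and that    *)
(* [n M A = scal M].  Put [B = S - (scal/n) g]; taking [X = Z = W] then gives *)
(* [B(Z,Z) g(MY,Z) = 0], so that [S(., Z) = 0] whenever [B(Z,Z) <> 0].  Such  *)
(* [Z] span if [B <> 0], whence [S = 0] and [B = 0], a contradiction.  So the *)
(* metric is Einstein at every point where [lam <> 0], even if [scal = 0],    *)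
(* and the remaining claims follow.                                           *)
(* The algebraic symmetries of the curvature are derived from its coordinate  *)
(* expression; skewness in the last two arguments rests on the equality of    *)
(* mixed second derivatives.                                                  *)

(* At a point, the hypothesis becomes the identity [derivation_curv] between two derivations of the
   curvature, and the scalar [lam] separates two cases. For [lam = 0] the right-hand side
   disappears, and a trace gives [ric_semisymmetric]. For [lam] nonzero, [wedge_starP] transfers to
   the wedge of $S$ a skewness that $R\cdot R$ always has; [star_commute] and [ric_einstein] turn it
   into $S=cg$ with $c=\kappa/n$. The Ricci operator is then $c$ times the identity, so (iii), (iv)
   and both conditions of (v) are computations with one scalar. Ricci semisymmetry thus holds in
   both cases. It lets the Ricci operator move across the last pair of arguments of $R$, and a
   contraction gives $E=S^2$ ([contraction_ricA]). Since the wedge of $S$ annihilates $S$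
   ([ric_wedge]), $P\cdot S$ equals $R\cdot S$. All this is linear algebra on coefficients whose
   symmetries come from [curvature_coef_bianchi] and [curvature_coef_skew]. *)
Require Import Defs.
From HB Require Import structures.
From mathcomp Require Import all_boot all_order all_algebra.
From mathcomp Require Import all_classical all_reals all_analysis.
From mathcomp Require Import ring lra.

Set Implicit Arguments.
Unset Strict Implicit.
Unset Printing Implicit Defensive.

Import Order.TTheory GRing.Theory Num.Theory.
Import numFieldNormedType.Exports.
Local Open Scope classical_set_scope.
Local Open Scope ring_scope.

(* mathcomp also has constants named [form] and [contraction]. *)
Local Notation form := Defs.form.
Local Notation contraction := Defs.contraction.

(** * Equality of mixed derivatives *)

Section MixedDerivatives.
Variables (R : realType) (V : normedModType R).
Implicit Types (f : V -> R) (x u v : V).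

Lemma is_derive_line f x u (s : R) : derivable f (x + s *: u) u ->
  is_derive s 1 (fun t => f (x + t *: u)) ('D_u f (x + s *: u)).
Proof.
have E : (fun h => h^-1 *: ((f (x + (h *: 1 + s) *: u)) - f (x + s *: u))) =
         (fun h => h^-1 *: (f (h *: u + (x + s *: u)) - f (x + s *: u))).
  by apply/funext => h; rewrite scalerDl addrCA [h *: 1]mulr1.
move=> fu; apply: DeriveDef; first by rewrite /derivable E.
by rewrite /derive E.
Qed.

(** The mean value theorem is used twice: along [u] for the difference of two parallel segments,
    then along [v] for ['D_u f]. The predicate [P] stands for a region containing the
    parallelogram. *)
Lemma second_difference f x u v (h : R) (P : V -> Prop) : 0 < h ->
  (forall s t, 0 <= s <= h -> 0 <= t <= h -> P (x + s *: u + t *: v)) ->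
  (forall y, P y -> derivable f y u /\ derivable ('D_u f) y v) ->
  exists2 y, P y & f (x + (h *: u + h *: v)) + f x
    - (f (x + h *: u) + f (x + h *: v)) = 'D_v ('D_u f) y * h ^+ 2.
Proof.
move=> h0 Pst fD.
have h00 : (0 : R) <= 0 <= h by rewrite lexx ltW.
have hh : 0 <= h <= h by rewrite lexx ltW.
pose phi s := f (x + h *: v + s *: u) - f (x + s *: u).
have phiD s : 0 <= s <= h -> is_derive s 1 phi
    ('D_u f (x + s *: u + h *: v) - 'D_u f (x + s *: u)).
  move=> sh; have [D1 _] := fD _ (Pst s h sh hh).
  have [D2 _] := fD _ (Pst s 0 sh h00).
  rewrite scale0r addr0 in D2; rewrite addrAC in D1 *.
  exact: (is_deriveB (is_derive_line D1) (is_derive_line D2)).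
have itvP (a : R) : a \in `[0, h] -> 0 <= a <= h by rewrite in_itv.
have itvoP (a : R) : a \in `]0, h[ -> 0 <= a <= h.
  by rewrite in_itv /= => /andP[/ltW -> /ltW ->].
have [s /itvoP sh] := MVT h0 (fun a ha => phiD a (itvoP a ha))
  (derivable_within_continuous (fun a ha => @ex_derive _ _ _ _ _ _ _ (phiD a (itvP a ha)))).
have psiD t : 0 <= t <= h -> is_derive t 1 (fun t => 'D_u f (x + s *: u + t *: v))
    ('D_v ('D_u f) (x + s *: u + t *: v)).
  by move=> th; have [_ D] := fD _ (Pst s t sh th); apply: is_derive_line.
have [t /itvoP th] := MVT h0 (fun a ha => psiD a (itvoP a ha))
  (derivable_within_continuous (fun a ha => @ex_derive _ _ _ _ _ _ _ (psiD a (itvP a ha)))).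
rewrite scale0r !subr0 addr0 => -> E; exists (x + s *: u + t *: v); first exact: Pst.
rewrite expr2 mulrA -E /phi !scale0r !addr0.
have -> : x + (h *: u + h *: v) = x + h *: v + h *: u by rewrite addrAC addrA.
by rewrite opprD opprB addrACA addrA.
Qed.

(** Both orders of differentiation express the same second difference, at points [y] and [z] so
    close to [x] that continuity bounds the gap by [e]. *)
Lemma derive_comm f x u v :
  (\forall y \near x, [/\ derivable f y u, derivable f y v,
     derivable ('D_u f) y v & derivable ('D_v f) y u]) ->
  {for x, continuous ('D_v ('D_u f))} -> {for x, continuous ('D_u ('D_v f))} ->
  'D_v ('D_u f) x = 'D_u ('D_v f) x.
Proof.
move=> fD cvu cuv; apply/eqP; rewrite -subr_eq0 -normr_le0.
apply/ler_addgt0Pr => e e0; rewrite add0r.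
have e20 : 0 < e / 2 by rewrite divr_gt0.
have tri (a b w : R) : `|a - w| < e / 2 -> `|b - w| < e / 2 -> `|a - b| <= e.
  move=> /ltW aw /ltW bw; rewrite (le_trans (ler_distD w _ _))// [leRHS](splitr e).
  by rewrite lerD// distrC.
move/cvgrPdist_lt: cvu => /(_ _ e20) cvu; move/cvgrPdist_lt: cuv => /(_ _ e20) cuv.
have [d /= d0 dP] := (@nbhs_ballP R V x _).1 (filterI fD (filterI cvu cuv)).
have near_x (w z : V) : exists2 h, 0 < h &
    forall s t, 0 <= s <= h -> 0 <= t <= h -> ball x d (x + s *: w + t *: z).
  (* The summand [1] keeps [N] positive and makes the final bound strict. *)
  pose N := `|w| + `|z| + 1; have N0 : 0 < N by rewrite ltr_wpDl ?addr_ge0.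
  exists (d / N) => [|s t]; first by rewrite divr_gt0.
  move=> /andP[s0 sh] /andP[t0 th]; rewrite -ball_normE /= -addrA opprD addrA subrr.
  rewrite sub0r normrN (le_lt_trans (ler_normD _ _))// !normrZ !ger0_norm//.
  rewrite (@le_lt_trans _ _ (d / N * (`|w| + `|z|)))//.
    by rewrite mulrDr lerD// ler_wpM2r.
  by rewrite -[ltRHS](divfK (lt0r_neq0 N0)) ltr_pM2l ?divr_gt0// ltrDl.
have [h1 h10 H1] := near_x u v; have [h2 h20 H2] := near_x v u.
pose h := Num.min h1 h2.
have h0 : 0 < h by rewrite lt_min h10.
have le1 s : 0 <= s <= h -> 0 <= s <= h1.
  by move=> /andP[->]; rewrite le_min => /andP[].
have le2 s : 0 <= s <= h -> 0 <= s <= h2.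
  by move=> /andP[->]; rewrite le_min => /andP[].
have [|y|y yd E1] := @second_difference f x u v h (ball x d) h0.
- by move=> s t /le1 sh /le1 th; exact: H1.
- by move=> /dP[[]].
have [|z|z zd E2] := @second_difference f x v u h (ball x d) h0.
- by move=> s t /le2 sh /le2 th; exact: H2.
- by move=> /dP[[]].
have E : 'D_v ('D_u f) y = 'D_u ('D_v f) z.
  apply: (@mulIf _ (h ^+ 2)); first by rewrite expf_neq0// lt0r_neq0.
  have EL := f_equal2 (fun p q => f (x + p) + f x - q)
    (addrC (h *: u) (h *: v)) (addrC (f (x + h *: u)) (f (x + h *: v))).
  exact: etrans (esym E1) (etrans EL E2).
have [_ [B1 _]] := dP _ yd; have [_ [_ B2]] := dP _ zd.
rewrite -E in B2; apply: tri B1 B2.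
Qed.

End MixedDerivatives.

(** * Differentiability of sums, products, determinants and inverse matrices *)

Section DirectionalDerivatives.
Variables (R : realType) (V : normedModType R).
Implicit Types (x v : V).

Lemma derivable_bigsum (I : Type) (r : seq I) (P : pred I) (F : I -> V -> R) x v :
  (forall i, derivable (F i) x v) ->
  derivable (fun y => \sum_(i <- r | P i) F i y) x v.
Proof.
move=> FD; have -> : (fun y => \sum_(i <- r | P i) F i y) = \sum_(i <- r | P i) F i.
  by apply/funext => y; rewrite fct_sumE.
apply: (big_ind (fun f : V -> R => derivable f x v)) => [|f g|i _].
- exact: derivable_cst.
- exact: derivableD.
- exact: FD.
Qed.

Lemma derive_bigsum (I : Type) (r : seq I) (P : pred I) (F : I -> V -> R) x v :
  (forall i, derivable (F i) x v) ->
  'D_v (fun y => \sum_(i <- r | P i) F i y) x = \sum_(i <- r | P i) 'D_v (F i) x.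
Proof.
move=> FD; have -> : (fun y => \sum_(i <- r | P i) F i y) = \sum_(i <- r | P i) F i.
  by apply/funext => y; rewrite fct_sumE.
suff : is_derive x v (\sum_(i <- r | P i) F i) (\sum_(i <- r | P i) 'D_v (F i) x).
  by move=> D; rewrite derive_val.
apply: (big_ind2 (fun (f : V -> R) df => is_derive x v f df)) => [|f df g dg Df Dg|i _].
- exact: is_derive_cst.
- exact: is_deriveD.
- exact: derivableP.
Qed.

Lemma derivable_bigprod (I : Type) (r : seq I) (P : pred I) (F : I -> V -> R) x v :
  (forall i, derivable (F i) x v) ->
  derivable (fun y => \prod_(i <- r | P i) F i y) x v.
Proof.
move=> FD; have -> : (fun y => \prod_(i <- r | P i) F i y) =
    \big[(fun f g : V -> R => f * g)/cst 1]_(i <- r | P i) F i.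
  apply/funext => y; apply: (big_ind2 (fun a (f : V -> R) => a = f y)) => //.
  by move=> a f b g -> ->.
apply: (big_ind (fun f : V -> R => derivable f x v)) => [|f g|i _].
- exact: derivable_cst.
- exact: derivableM.
- exact: FD.
Qed.

Lemma derivable_det n (A : V -> 'M[R]_n) x v :
  (forall i j, derivable (fun y => A y i j) x v) ->
  derivable (fun y => \det (A y)) x v.
Proof.
move=> AD; apply: derivable_bigsum => s; apply: derivableM.
  exact: derivable_cst.
by apply: derivable_bigprod.
Qed.

Lemma eq_open_derive (W : normedModType R) (U : set V) (f g : V -> W) x v :
  open U -> U x -> (forall y, U y -> f y = g y) -> 'D_v f x = 'D_v g x.
Proof.
move=> oU Ux fg; apply: near_eq_derive; exact: filterS fg (open_nbhs_nbhs (conj oU Ux)).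
Qed.

Lemma eq_open_derivable (W : normedModType R) (U : set V) (f g : V -> W) x v :
  open U -> U x -> (forall y, U y -> f y = g y) ->
  derivable f x v -> derivable g x v.
Proof.
move=> oU Ux fg; apply: near_eq_derivable; exact: filterS fg (open_nbhs_nbhs (conj oU Ux)).
Qed.

(** Cramer's formula describes [invmx] only where the matrix is invertible, hence the open set [U]
    around [x]. *)
Lemma derivable_invmx n (A : V -> 'M[R]_n) (U : set V) x v i j :
  open U -> U x -> (forall y, U y -> A y \in unitmx) ->
  (forall i j, derivable (fun y => A y i j) x v) ->
  derivable (fun y => invmx (A y) i j) x v.
Proof.
move=> oU Ux Au AD.
apply: (@eq_open_derivable _ U (fun y => (\det (A y))^-1 * ((-1) ^+ (j + i) *
   \det (row' j (col' i (A y)))))) => // [y Uy|].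
  by rewrite /invmx Au// !mxE.
apply: derivableM.
  apply: derivableV; last exact: derivable_det.
  by have := Au _ Ux; rewrite unitmxE unitfE.
apply: derivableM; first exact: derivable_cst.
apply: derivable_det => k l; under eq_fun do rewrite !mxE.
exact: AD.
Qed.

End DirectionalDerivatives.

(** * Smooth functions on an open set *)

Section SmoothFunctions.
Variables (R : realType) (n : nat) (U : set 'rV[R]_n).
Hypothesis oU : open U.
Implicit Types (f : 'rV[R]_n -> R) (x : 'rV[R]_n).

Lemma smooth_on_pder f a : smooth_on U f -> smooth_on U (pder a f).
Proof. by move=> fs k; have [_ /(_ a)[]] := fs k.+1. Qed.

Lemma smooth_on_continuous f x : smooth_on U f -> U x -> {for x, continuous f}.
Proof. by move=> /(_ 0%N)[+ _]; exact. Qed.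

Lemma smooth_on_derivable f x a :
  smooth_on U f -> U x -> derivable f x (delta_mx 0 a).
Proof. by move=> /(_ 1%N)[_ /(_ a)[+ _]]; exact. Qed.

Lemma pderC f x a b : smooth_on U f -> U x ->
  pder a (pder b f) x = pder b (pder a f) x.
Proof.
move=> fs Ux; apply: derive_comm.
- apply: filterS (open_nbhs_nbhs (conj oU Ux)) => y Uy.
  by split; apply: smooth_on_derivable => //; exact: smooth_on_pder.
- by apply: smooth_on_continuous => //; do 2 apply: smooth_on_pder.
- by apply: smooth_on_continuous => //; do 2 apply: smooth_on_pder.
Qed.

End SmoothFunctions.

(** * Symmetries of the curvature *)

(* [G c a b] are the connection coefficients at a point and [P a c b d] stands *)
(* for the [a]-th partial derivative of [G c b d].                            *)
Section CurvatureAlgebra.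
Variables (F : comNzRingType) (n : nat).
Variables (P : 'I_n -> 'I_n -> 'I_n -> 'I_n -> F) (G : 'I_n -> 'I_n -> 'I_n -> F).
Implicit Types a b c d e m : 'I_n.

Definition coef a b c d : F :=
  P a d b c - P b d a c + \sum_m (G m b c * G d a m - G m a c * G d b m).

Lemma coefC a b c d : coef a b c d = - coef b a c d.
Proof.
rewrite /coef opprD opprB -sumrN; congr (_ + _).
by apply: eq_bigr => m _; rewrite opprB.
Qed.

(** The connection is torsion-free: with symmetric lower indices, all terms of the cyclic sum cancel
    in pairs. *)
Lemma coef_bianchi a b c d :
  (forall c a b, G c a b = G c b a) -> (forall e c a b, P e c a b = P e c b a) ->
  coef a b c d + coef b c a d + coef c a b d = 0.
Proof.
move=> GC PC; rewrite /coef (PC a d c b) (PC b d a c) (PC c d b a).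
set s1 := \sum_m _; set s2 := \sum_m _; set s3 := \sum_m _.
suff s0 : s1 + s2 + s3 = 0 by rewrite -[RHS]s0; ring.
rewrite /s1 /s2 /s3 -!big_split /= big1// => m _.
by rewrite (GC m c a) (GC m b a) (GC m c b); ring.
Qed.

(* [C] is the Christoffel symbol of the first kind, [PC] its derivative.      *)
Lemma coef_skew (g : 'I_n -> 'I_n -> F) (C : 'I_n -> 'I_n -> 'I_n -> F)
    (PC : 'I_n -> 'I_n -> 'I_n -> 'I_n -> F) a b c d :
  (forall m k, g m k = g k m) ->
  (forall b c d, \sum_m G m b c * g m d = C b c d) ->
  (forall a b c d, \sum_m P a m b c * g m d =
     PC a b c d - \sum_m G m b c * (C a m d + C a d m)) ->
  (forall c d, PC a b c d + PC a b d c = PC b a c d + PC b a d c) ->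
  \sum_e coef a b c e * g e d = - \sum_e coef a b d e * g e c.
Proof.
move=> gC GE PE PCC.
(* This is $g(\nabla_a e_b,\nabla_c e_d)$, hence symmetric under exchange of the two pairs. *)
pose Q a b c d := \sum_m G m a b * C c d m.
have QC a' b' c' d' : Q a' b' c' d' = Q c' d' a' b'.
  rewrite /Q; under eq_bigr => m _ do rewrite -GE mulr_sumr.
  under [RHS]eq_bigr => m _ do rewrite -GE mulr_sumr.
  rewrite exchange_big /=; apply: eq_bigr => k _; apply: eq_bigr => m _.
  by rewrite (gC m k); ring.
have lowerE c' d' : \sum_e coef a b c' e * g e d' =
    PC a b c' d' - PC b a c' d' - Q b c' a d' + Q a c' b d'.
  rewrite /coef; under eq_bigr => e _ do rewrite mulrDl mulrBl.
  rewrite big_split sumrB /= !PE.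
  have -> : \sum_e (\sum_m (G m b c' * G e a m - G m a c' * G e b m)) * g e d' =
      \sum_m G m b c' * C a m d' - \sum_m G m a c' * C b m d'.
    under eq_bigr => e _ do rewrite mulr_suml.
    rewrite exchange_big /= -sumrB; apply: eq_bigr => m _; rewrite -!GE.
    by rewrite !mulr_sumr -sumrB; apply: eq_bigr => e _; ring.
  under eq_bigr => m _ do rewrite mulrDr.
  under [X in _ - (_ - X)]eq_bigr => m _ do rewrite mulrDr.
  by rewrite !big_split /= /Q; ring.
(* The quadratic terms cancel by [QC]; what remains is the symmetry of the second derivatives of the
   metric. *)
apply/eqP; rewrite -addr_eq0 !lowerE (QC b d a c) (QC a d b c).
have -> : PC a b c d = PC b a c d + PC b a d c - PC a b d c by rewrite -PCC addrK.
by apply/eqP; ring.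
Qed.

End CurvatureAlgebra.

(** * Symmetries of the curvature of a smooth metric in a chart *)

Section CurvatureSymmetries.
Variables (R : realType) (n : nat) (G : 'rV[R]_n -> 'M[R]_n) (U : set 'rV[R]_n).
Hypothesis oU : open U.
Hypothesis Gsym : forall x, U x -> (G x)^T = G x.
Hypothesis Gunit : forall x, U x -> G x \in unitmx.
Hypothesis Gsmooth : forall a b, smooth_on U (fun x => G x a b).
Implicit Types (x : 'rV[R]_n) (a b c d m : 'I_n).

Lemma curvature_coefE a b c d x : curvature_coef G a b c d x =
  coef (fun a d b c => pder a (christoffel G d b c) x)
       (fun c a b => christoffel G c a b x) a b c d.
Proof. by []. Qed.

Lemma curvature_coefC a b c d x :
  curvature_coef G a b c d x = - curvature_coef G b a c d x.
Proof. by rewrite !curvature_coefE; exact: (@coefC R). Qed.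

Definition christoffel1 b c d x := 2^-1 * (pder b (fun y => G y c d) x
  + pder c (fun y => G y b d) x - pder d (fun y => G y b c) x).

Lemma gmatC x a b : U x -> G x a b = G x b a.
Proof. by move=> Ux; rewrite -[in LHS](Gsym Ux) mxE. Qed.

Lemma pder_gmatC x a b c : U x ->
  pder c (fun y => G y a b) x = pder c (fun y => G y b a) x.
Proof. by move=> Ux; apply: (eq_open_derive _ oU Ux) => y; exact: gmatC. Qed.

Lemma christoffelC c a b x : U x -> christoffel G c a b x = christoffel G c b a x.
Proof.
move=> Ux; rewrite /christoffel; congr (_ * _); apply: eq_bigr => d _.
rewrite (pder_gmatC a b d Ux).
move: (invmx _ _ _) (pder a _ _) (pder b _ _) (pder d _ _) => p q r s.
by rewrite (addrC r).
Qed.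

Lemma curvature_coef_bianchi a b c d x : U x ->
  curvature_coef G a b c d x + curvature_coef G b c a d x
  + curvature_coef G c a b d x = 0.
Proof.
move=> Ux; rewrite !curvature_coefE.
apply: (@coef_bianchi R n _ _ a b c d) => [c' a' b'|e c' a' b'].
  exact: christoffelC.
by apply: (eq_open_derive _ oU Ux) => y; exact: christoffelC.
Qed.

Lemma christoffel1E b c d x : U x ->
  \sum_m christoffel G m b c x * G x m d = christoffel1 b c d x.
Proof.
move=> Ux; pose D k := pder b (fun y => G y c k) x
  + pder c (fun y => G y b k) x - pder k (fun y => G y b c) x.
rewrite /christoffel /christoffel1 -/(D d).
transitivity (2^-1 * \sum_k (G x *m invmx (G x)) d k * D k).
  under eq_bigr => m _ do rewrite -mulrA mulr_suml.
  rewrite -mulr_sumr exchange_big /=; congr (_ * _); apply: eq_bigr => k _.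
  rewrite mxE mulr_suml; apply: eq_bigr => m _; rewrite (gmatC d m Ux) -/(D k).
  by move: (D k) => z; ring.
rewrite mulmxV ?Gunit// (bigD1 d)//= big1 ?addr0 => [|k kd].
  by rewrite mxE eqxx mul1r.
by rewrite mxE eq_sym (negbTE kd) mul0r.
Qed.

Lemma christoffel1_derivable b c d x a :
  U x -> derivable (christoffel1 b c d) x (delta_mx 0 a).
Proof.
move=> Ux.
have S p q r : derivable (pder p (fun y => G y q r)) x (delta_mx 0 a).
  exact: smooth_on_derivable (smooth_on_pder p (Gsmooth q r)) Ux.
apply: derivableM; first exact: derivable_cst.
apply: derivableB; last exact: S.
by apply: derivableD; exact: S.
Qed.

Lemma christoffel_derivable c a b x e :
  U x -> derivable (christoffel G c a b) x (delta_mx 0 e).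
Proof.
move=> Ux.
have S p q r : derivable (pder p (fun y => G y q r)) x (delta_mx 0 e).
  exact: smooth_on_derivable (smooth_on_pder p (Gsmooth q r)) Ux.
apply: derivableM; first exact: derivable_cst.
apply: derivable_bigsum => d; apply: derivableM.
  apply: (derivable_invmx oU Ux) => // i j.
  exact: smooth_on_derivable (Gsmooth i j) Ux.
apply: derivableB; last exact: S.
by apply: derivableD; exact: S.
Qed.

(** This is $\nabla g=0$ in coordinates. *)
Lemma pder_gmat a m d x : U x ->
  pder a (fun y => G y m d) x = christoffel1 a m d x + christoffel1 a d m x.
Proof.
move=> Ux; rewrite /christoffel1 (pder_gmatC d m a Ux).
move: (pder a _ x) (pder m _ x) (pder d _ x) => p q r.
by field.
Qed.

(** Leibniz rule for the lowered symbol [christoffel1E], with the derivative of the metric given by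
    [pder_gmat]. *)
Lemma lower_pder_christoffel a b c d x : U x ->
  \sum_m pder a (christoffel G m b c) x * G x m d =
  pder a (christoffel1 b c d) x - \sum_m christoffel G m b c x *
    (christoffel1 a m d x + christoffel1 a d m x).
Proof.
move=> Ux; have Gd m : derivable (fun y => G y m d) x (delta_mx 0 a).
  exact: smooth_on_derivable (Gsmooth m d) Ux.
apply/eqP; rewrite eq_sym subr_eq; apply/eqP.
have <- : pder a (fun y => \sum_m christoffel G m b c y * G y m d) x =
    pder a (christoffel1 b c d) x.
  by apply: (eq_open_derive _ oU Ux) => y Uy; rewrite christoffel1E.
rewrite -big_split; apply: (etrans (derive_bigsum (index_enum 'I_n) predT
  (fun m => derivableM (@christoffel_derivable m b c x a Ux) (Gd m)))).
apply: eq_bigr => m _.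
apply: (etrans (deriveM (@christoffel_derivable m b c x a Ux) (Gd m))).
have E (p q r s t : R) : q = t -> p * q + s * r = r * s + p * t.
  by move=> ->; ring.
exact: E (pder_gmat a m d Ux).
Qed.

Lemma curvature_coef_skew a b c d x : U x ->
  \sum_e curvature_coef G a b c e x * G x e d
  = - \sum_e curvature_coef G a b d e x * G x e c.
Proof.
move=> Ux; apply: (@coef_skew R n
  (fun a d b c => pder a (christoffel G d b c) x) (fun c a b => christoffel G c a b x)
  (fun m d => G x m d) (fun b c d => christoffel1 b c d x)
  (fun a b c d => pder a (christoffel1 b c d) x) a b c d).
- by move=> m k; exact: gmatC.
- by move=> *; exact: christoffel1E.
- by move=> *; exact: lower_pder_christoffel.
move=> c' d'.
have E p q : pder p (christoffel1 q c' d') x + pder p (christoffel1 q d' c') x =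
    pder p (pder q (fun y => G y c' d')) x.
  transitivity (pder p (christoffel1 q c' d' + christoffel1 q d' c') x).
    by apply/esym/deriveD; exact: christoffel1_derivable.
  by apply: (eq_open_derive _ oU Ux) => y Uy; rewrite pder_gmat.
exact: etrans (E a b) (etrans (@pderC R n U oU _ x a b (Gsmooth c' d') Ux) (esym (E b a))).
Qed.

End CurvatureSymmetries.

(** * Bilinear forms and contractions *)

Section Forms.
Variables (R : realType) (n : nat).
Implicit Types (h M : 'M[R]_n) (X Y Z W : 'rV[R]_n).

Lemma formE h X Y : form h X Y = \sum_a \sum_b X 0 a * h a b * Y 0 b.
Proof.
rewrite /form mxE exchange_big /=; apply: eq_bigr => b _.
by rewrite !mxE mulr_suml.
Qed.

Lemma formDl h X Y Z : form h (X + Y) Z = form h X Z + form h Y Z.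
Proof. by rewrite /form !mulmxDl mxE. Qed.

Lemma formZl h c X Y : form h (c *: X) Y = c * form h X Y.
Proof. by rewrite /form -!scalemxAl mxE. Qed.

Lemma formNl h X Y : form h (- X) Y = - form h X Y.
Proof. by rewrite /form !mulNmx mxE. Qed.

Lemma formBl h X Y Z : form h (X - Y) Z = form h X Z - form h Y Z.
Proof. by rewrite formDl formNl. Qed.

Lemma formDr h X Y Z : form h Z (X + Y) = form h Z X + form h Z Y.
Proof. by rewrite /form linearD mulmxDr mxE. Qed.

Lemma formZr h c X Y : form h Y (c *: X) = c * form h Y X.
Proof. by rewrite /form linearZ -scalemxAr mxE. Qed.

Lemma formBr h X Y Z : form h Z (X - Y) = form h Z X - form h Z Y.
Proof. by rewrite formDr -scaleN1r formZr mulN1r. Qed.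

Lemma formMl h M X Y : form h (X *m M) Y = form (M *m h) X Y.
Proof. by rewrite /form !mulmxA. Qed.

Lemma formMr h M X Y : form h X (Y *m M) = form (h *m M^T) X Y.
Proof. by rewrite /form trmx_mul !mulmxA. Qed.

Lemma formT h X Y : form h X Y = form h^T Y X.
Proof.
rewrite !formE exchange_big; apply: eq_bigr => b _; apply: eq_bigr => a _.
by rewrite mxE; ring.
Qed.

Lemma form_col_row (c : 'cV[R]_n) (r : 'rV[R]_n) X Y :
  form (c *m r) X Y = (X *m c) 0 0 * (r *m Y^T) 0 0.
Proof. by rewrite /form mulmxA -mulmxA [LHS]mxE big_ord1. Qed.

Lemma form_mxD h M X Y : form (h + M) X Y = form h X Y + form M X Y.
Proof. by rewrite /form mulmxDr mulmxDl mxE. Qed.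

Lemma form_mxZ c M X Y : form (c *: M) X Y = c * form M X Y.
Proof. by rewrite /form -scalemxAr -scalemxAl mxE. Qed.

Lemma form_mxN M X Y : form (- M) X Y = - form M X Y.
Proof. by rewrite -scaleN1r form_mxZ mulN1r. Qed.

Lemma form_mx0 X Y : form (0 : 'M[R]_n) X Y = 0.
Proof. by rewrite /form mulmx0 mul0mx mxE. Qed.

Lemma form_delta h a b : form h (delta_mx 0 a) (delta_mx 0 b) = h a b.
Proof. by rewrite /form -rowE trmx_delta -colE !mxE. Qed.

Lemma form_inj h M : (forall X Y, form h X Y = form M X Y) -> h = M.
Proof. by move=> hM; apply/matrixP => a b; rewrite -!form_delta. Qed.

End Forms.

Section Contractions.
Variables (R : realType) (n : nat) (h : 'M[R]_n).
Hypotheses (hT : h^T = h) (hU : h \in unitmx).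
Implicit Types (X Y Z W : 'rV[R]_n) (M : 'M[R]_n).

Lemma invmxT : (invmx h)^T = invmx h. Proof. by rewrite trmx_inv hT. Qed.

Lemma formC X Y : form h X Y = form h Y X. Proof. by rewrite formT hT. Qed.

Lemma contraction_form M : contraction h (form M) = \tr (M *m invmx h).
Proof.
rewrite /contraction /mxtrace; apply: eq_bigr => a _; rewrite mxE.
by apply: eq_bigr => b _; rewrite form_delta mulrC -[in LHS]invmxT mxE.
Qed.

Lemma eq_contraction (B C : 'rV[R]_n -> 'rV[R]_n -> R) :
  (forall X Y, B X Y = C X Y) -> contraction h B = contraction h C.
Proof. by move=> BC; apply: eq_bigr => a _; apply: eq_bigr => b _; rewrite BC. Qed.

Lemma contractionT (B : 'rV[R]_n -> 'rV[R]_n -> R) :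
  contraction h B = contraction h (fun X Y => B Y X).
Proof.
rewrite /contraction exchange_big; apply: eq_bigr => a _; apply: eq_bigr => b _.
by rewrite -[in LHS]invmxT mxE.
Qed.

Lemma sharp_formE M X (w : 'rV[R]_n -> R) :
  (forall Y, w Y = form M X Y) -> sharp h w = X *m (M *m invmx h).
Proof.
move=> wE; rewrite mulmxA; apply/rowP => b; rewrite !mxE; apply: eq_bigr => a _.
by rewrite wE /form trmx_delta -colE mxE.
Qed.

Lemma sharp_metric X (w : 'rV[R]_n -> R) :
  (forall Y, w Y = form h X Y) -> sharp h w = X.
Proof. by move=> /sharp_formE ->; rewrite mulmxV ?mulmx1. Qed.

(** The hypothesis makes [M] similar to the negative of its transpose. *)
Lemma skew_tr M : (M *m h)^T = - (M *m h) -> \tr M = 0.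
Proof.
move=> Mh; have E : \tr M = - \tr M.
  rewrite -[M in LHS](mulmxK hU) -mxtrace_tr trmx_mul invmxT Mh mulmxN linearN /=.
  by rewrite mxtrace_mulC mulmxK.
by lra.
Qed.

(* For a curvature operator [M = R(Z1, Z2)], the hypothesis on [star] is the  *)
(* skew-symmetry of [Q(S, R)] in the last two arguments of [R].               *)
Lemma star_commute (S M : 'M[R]_n) : S^T = S -> (M *m h)^T = - (M *m h) ->
  let star X Y Z W := form S Y (Z *m M) * form h X W - form S X (Z *m M) * form h Y W
    - form S Y Z * form h (X *m M) W + form S X Z * form h (Y *m M) W in
  (forall X Y Z W, star X Y Z W + star X Y W Z = 0) ->
  let A := S *m invmx h in n%:R *: (M *m A) = \tr A *: M /\ A *m M = M *m A.
Proof.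
move=> ST MS star starP A; have SA : S *m invmx h = A by []; clearbody A.
have hMT : h *m M^T = - (M *m h) by rewrite -MS trmx_mul hT.
have SE : S = A *m h by rewrite -SA mulmxKV.
have hAT : h *m A^T = A *m h by rewrite -[in LHS]hT -trmx_mul -SE.
have SMT : S *m M^T = - (A *m M *m h) by rewrite SE -mulmxA hMT mulmxN mulmxA.
(* [N Y Z] is the matrix, in [X] and [W], of the vanishing sum. Products of linear forms become
   rank-one matrices, so contracting [X] with [W] is taking a trace. *)
pose N Y Z := form S Y (Z *m M) *: h - (S *m (Z *m M)^T) *m (Y *m h)
  - form S Y Z *: (M *m h) + (S *m Z^T) *m (Y *m (M *m h))
  + ((h *m Z^T) *m (Y *m (S *m M^T)) - form h Y Z *: (S *m M^T)
     - (M *m h *m Z^T) *m (Y *m S) + form h (Y *m M) Z *: S).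
have NE Y Z : N Y Z = 0.
  apply: form_inj => X W; rewrite /N !(form_mxD, form_mxN, form_mxZ, form_col_row).
  rewrite form_mx0 -[RHS](starP X Y Z W) /star.
  by rewrite !(formMl, formMr) /form !trmx_mul !mulmxA; ring.
have trAM : \tr (A *m M) = 0.
  have E : \tr (A *m M) = - \tr (A *m M).
    rewrite -[LHS]mxtrace_tr trmx_mul -[A^T](mulKmx hU) -[M^T](mulKmx hU) hMT hAT.
    rewrite mulmxN mulNmx raddfN /= !mulmxA mulmxK // mxtrace_mulC.
    by rewrite !mulmxA mulmxV // mul1mx mxtrace_mulC.
  by lra.
have trSM : \tr (S *m M^T *m invmx h) = 0.
  by rewrite SMT mulNmx mulmxK // raddfN /= trAM oppr0.
have key : - ((n%:R + 1) *: (A *m M)) + M *m A + \tr A *: M = 0.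
  suff : (- ((n%:R + 1) *: (A *m M)) + M *m A + \tr A *: M) *m h = 0.
    by move/(congr1 (mulmxr (invmx h))); rewrite /= mulmxK ?mul0mx.
  apply: form_inj => Y Z.
  have trcr (c : 'cV[R]_n) (r : 'rV[R]_n) : \tr (c *m r *m invmx h) = (r *m invmx h *m c) 0 0.
    by rewrite -mulmxA mxtrace_mulC trace_mx11.
  have := congr1 (fun B => \tr (B *m invmx h)) (NE Y Z).
  rewrite mul0mx raddf0 /N !(mulmxDl, mulNmx) -!scalemxAl.
  rewrite !(mxtraceD, mxtraceZ, raddfN) /= !trcr SA !mulmxK // mulmxV // mxtrace1.
  rewrite !mxtraceZ (skew_tr MS) trSM form_mx0 => NE0.
  rewrite !(form_mxD, form_mxN, form_mxZ) -[RHS]NE0.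
  have E1 : form S Y (Z *m M) = - form (A *m M *m h) Y Z by rewrite formMr SMT form_mxN.
  have -> : (Y *m (S *m (Z *m M)^T)) 0 0 = - form (A *m M *m h) Y Z.
    by rewrite -E1 /form !mulmxA.
  have -> : (Y *m (S *m M^T) *m invmx h *m (h *m Z^T)) 0 0 =
      - form (A *m M *m h) Y Z.
    by rewrite -E1 formMr /form mulmxA mulmxKV.
  have -> : (Y *m (M *m h) *m invmx h *m (S *m Z^T)) 0 0 = form (M *m A *m h) Y Z.
    by rewrite SE /form !mulmxA mulmxK.
  have -> : (Y *m S *m invmx h *m (M *m h *m Z^T)) 0 0 = form (A *m M *m h) Y Z.
    by rewrite -(mulmxA Y) SA /form !mulmxA.
  have -> : form h (Y *m M) Z = form (M *m h) Y Z by rewrite formMl.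
  by rewrite E1; ring.
(* The adjoint of [key] with respect to [h], where [A] is self-adjoint and [M] is skew. Adding the
   two leaves $(n+2)(MA-AM)=0$. *)
have keyT : (n%:R + 1) *: (M *m A) - A *m M - \tr A *: M = 0.
  have : ((n%:R + 1) *: (M *m A) - A *m M - \tr A *: M) *m h = 0.
    rewrite -[RHS](mulmx0 _ h) -trmx0 -key !(linearD, linearN, linearZ) /=.
    rewrite !trmx_mul !(mulmxDr, mulmxN, mulmxDl, mulNmx) -!(scalemxAl, scalemxAr).
    rewrite (mulmxA h M^T) (mulmxA h A^T) hMT hAT !mulNmx -(mulmxA M h) -(mulmxA A h).
    by rewrite hMT hAT mulmxN !mulmxA !scalerN opprK.
  by move/(congr1 (mulmxr (invmx h))); rewrite /= mulmxK ?mul0mx.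
have n2 : n%:R + 2 != 0 :> R by rewrite -(natrD R n 2) pnatr_eq0 addn_eq0 andbF.
have AM : A *m M = M *m A.
  have E : (n%:R + 2) *: (M *m A - A *m M) = 0.
    rewrite -[RHS]addr0 -{1}key -keyT.
    by apply/matrixP => a b; rewrite !mxE; ring.
  by move/eqP: E; rewrite scaler_eq0 (negbTE n2) subr_eq0 => /eqP.
split=> //; apply/eqP; rewrite -subr_eq0 -keyT AM; apply/eqP.
by rewrite scalerDl scale1r addrK.
Qed.

End Contractions.

(** * Algebraic curvature tensors *)

Section AlgebraicCurvature.
Variables (R : realType) (n : nat) (h : 'M[R]_n).
Variable K : 'I_n -> 'I_n -> 'I_n -> 'I_n -> R.
Hypotheses (hT : h^T = h) (hU : h \in unitmx).
Hypothesis KC : forall a b c d, K a b c d = - K b a c d.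
Hypothesis KB : forall a b c d, K a b c d + K b c a d + K c a b d = 0.
Hypothesis KS : forall a b c d,
  \sum_e K a b c e * h e d = - \sum_e K a b d e * h e c.
Implicit Types X Y Z W U : 'rV[R]_n.

Definition curv X Y Z : 'rV[R]_n := \row_d \sum_a \sum_b \sum_c
  X 0 a * Y 0 b * Z 0 c * K a b c d.

(** The operator $R(X,Y)$, acting on row vectors from the right. *)
Definition rho X Y : 'M[R]_n := \matrix_(c, d) \sum_a \sum_b X 0 a * Y 0 b * K a b c d.

(** The operator $X\mapsto R(X,Y)Z$, whose trace is the Ricci tensor. *)
Definition tau Y Z : 'M[R]_n := \matrix_(a, d) \sum_b \sum_c Y 0 b * Z 0 c * K a b c d.

Definition Rm X Y Z W := form h (curv X Y Z) W.

Definition ric X Y := contraction h (fun X1 X2 => Rm X1 X Y X2).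

Definition ricM : 'M[R]_n := \matrix_(b, c) \sum_a K a b c a.

Definition ricA : 'M[R]_n := ricM *m invmx h.

Lemma curv_rho X Y Z : curv X Y Z = Z *m rho X Y.
Proof.
apply/rowP => d; rewrite !mxE.
under [RHS]eq_bigr => c _ do rewrite mxE mulr_sumr.
rewrite [RHS]exchange_big /=; apply: eq_bigr => a _.
under [RHS]eq_bigr => c _ do rewrite mulr_sumr.
rewrite [RHS]exchange_big /=; apply: eq_bigr => b _.
by apply: eq_bigr => c _; ring.
Qed.

Lemma curv_tau X Y Z : curv X Y Z = X *m tau Y Z.
Proof.
apply/rowP => d; rewrite !mxE; apply: eq_bigr => a _; rewrite mxE mulr_sumr.
apply: eq_bigr => b _; rewrite mulr_sumr; apply: eq_bigr => c _.
by ring.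
Qed.

Lemma curvC X Y Z : curv X Y Z = - curv Y X Z.
Proof.
apply/rowP => d; rewrite !mxE exchange_big -sumrN /=; apply: eq_bigr => b _.
rewrite -sumrN; apply: eq_bigr => a _; rewrite -sumrN; apply: eq_bigr => c _.
by rewrite (KC b a) KC; ring.
Qed.

Lemma curv_bianchi X Y Z : curv X Y Z + curv Y Z X + curv Z X Y = 0.
Proof.
apply/rowP => d; rewrite !mxE.
have -> : \sum_b \sum_c \sum_a Y 0 b * Z 0 c * X 0 a * K b c a d =
    \sum_a \sum_b \sum_c Y 0 b * Z 0 c * X 0 a * K b c a d.
  rewrite [RHS]exchange_big; apply: eq_bigr => b _; exact: exchange_big.
have -> : \sum_c \sum_a \sum_b Z 0 c * X 0 a * Y 0 b * K c a b d =
    \sum_a \sum_b \sum_c Z 0 c * X 0 a * Y 0 b * K c a b d.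
  rewrite exchange_big; apply: eq_bigr => a _; exact: exchange_big.
rewrite -!big_split big1 //= => a _; rewrite -!big_split big1 //= => b _.
rewrite -!big_split big1 //= => c _.
by rewrite -[RHS](mulr0 (X 0 a * Y 0 b * Z 0 c)) -(KB a b c d); ring.
Qed.

Lemma Rm12 X Y Z W : Rm X Y Z W = - Rm Y X Z W.
Proof. by rewrite /Rm curvC formNl. Qed.

Lemma rho_skew X Y : (rho X Y *m h)^T = - (rho X Y *m h).
Proof.
have rhoE c d : (rho X Y *m h) c d =
    \sum_a \sum_b X 0 a * Y 0 b * \sum_e K a b c e * h e d.
  rewrite mxE; under eq_bigr => e _ do rewrite mxE mulr_suml.
  rewrite exchange_big /=; apply: eq_bigr => a _.
  under eq_bigr => e _ do rewrite mulr_suml.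
  rewrite exchange_big /=; apply: eq_bigr => b _; rewrite mulr_sumr.
  by apply: eq_bigr => e _; ring.
apply/matrixP => d c; rewrite [LHS]mxE [RHS]mxE !rhoE -sumrN.
apply: eq_bigr => a _; rewrite -sumrN; apply: eq_bigr => b _.
by rewrite KS mulrN.
Qed.

Lemma Rm34 X Y Z W : Rm X Y Z W = - Rm X Y W Z.
Proof.
by rewrite /Rm !curv_rho !formMl formT rho_skew form_mxN.
Qed.

(** The classical octahedron argument: four cyclic identities are combined by means of the two
    skew-symmetries. *)
Lemma Rm_pair X Y Z W : Rm X Y Z W = Rm Z W X Y.
Proof.
have B X1 X2 X3 X4 : Rm X1 X2 X3 X4 + Rm X2 X3 X1 X4 + Rm X3 X1 X2 X4 = 0.
  by rewrite /Rm -!formDl curv_bianchi -(scale0r X1) formZl mul0r.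
have := B X Y Z W; have := B Y Z W X; have := B Z W X Y; have := B W X Y Z.
rewrite (Rm12 Z X) (Rm34 Y Z W X) (Rm34 Z W Y X) (Rm12 W Y) (Rm34 Y W Z X).
rewrite (Rm12 W X Z Y) (Rm34 X W Z Y) (Rm34 X Z W Y) (Rm12 W X Y Z) (Rm34 X Y W Z).
by lra.
Qed.

Lemma ricE X Y : ric X Y = \tr (tau X Y).
Proof.
rewrite -[tau X Y](mulmxK hU) -contraction_form //; apply: eq_contraction => U W.
by rewrite /Rm curv_tau formMl.
Qed.

Lemma ric_form X Y : ric X Y = form ricM X Y.
Proof.
rewrite ricE formE /mxtrace; under eq_bigr => a _ do rewrite mxE.
rewrite exchange_big /=; apply: eq_bigr => b _; rewrite exchange_big /=.
by apply: eq_bigr => c _; rewrite mxE mulr_sumr mulr_suml; apply: eq_bigr => a _; ring.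
Qed.

Lemma ricC X Y : ric X Y = ric Y X.
Proof.
rewrite {1}/ric contractionT //; apply: eq_contraction => U W.
by rewrite Rm_pair Rm12 Rm34 opprK.
Qed.

Lemma ricM_sym : ricM^T = ricM.
Proof. by apply: form_inj => X Y; rewrite -formT -!ric_form ricC. Qed.

Lemma ricA_h : ricA *m h = ricM. Proof. by rewrite mulmxKV. Qed.

Lemma scalE : contraction h ric = \tr ricA.
Proof. by rewrite (eq_contraction _ ric_form) contraction_form. Qed.

Lemma ricopE X : sharp h (ric X) = X *m ricA.
Proof. by apply: sharp_formE => Y; exact: ric_form. Qed.

Lemma curv_lin1 c U X Y Z : curv (X - c *: U) Y Z = curv X Y Z - c *: curv U Y Z.
Proof. by rewrite !curv_tau mulmxBl scalemxAl. Qed.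

Lemma curv_lin2 c U X Y Z : curv Y (X - c *: U) Z = curv Y X Z - c *: curv Y U Z.
Proof. by rewrite curvC curv_lin1 !(curvC _ Y) opprB scalerN opprK addrC. Qed.

Lemma curv_lin3 c U X Y Z : curv Y Z (X - c *: U) = curv Y Z X - c *: curv Y Z U.
Proof. by rewrite !curv_rho mulmxBl scalemxAl. Qed.

Definition proj X1 X2 X3 X4 := Rm X1 X2 X3 X4
  - (n%:R - 1)^-1 * (ric X2 X3 * form h X1 X4 - ric X1 X3 * form h X2 X4).

Lemma assoc_Rm X Y Z : assoc13 h Rm X Y Z = curv X Y Z.
Proof. exact: sharp_metric. Qed.

Lemma assoc_proj X Y Z : assoc13 h proj X Y Z =
  curv X Y Z - (n%:R - 1)^-1 *: wedge_op ric X Y Z.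
Proof. by apply: sharp_metric => // W; rewrite formBl formZl formBl !formZl. Qed.

Definition derivation (ell : 'rV[R]_n -> 'rV[R]_n) (Z1 Z2 Z3 : 'rV[R]_n) :=
  ell (curv Z1 Z2 Z3) - (curv (ell Z1) Z2 Z3 + curv Z1 (ell Z2) Z3
                         + curv Z1 Z2 (ell Z3)).

Lemma act_vec3 ell Xs :
  act_vec ell (vec3 curv) Xs = derivation ell (Xs 0) (Xs 1) (Xs 2).
Proof. by rewrite /act_vec !big_ord_recl big_ord0 addr0 addrA. Qed.

Lemma derivation_lin (f g ell : 'rV[R]_n -> 'rV[R]_n) c Z1 Z2 Z3 :
  (forall Z, ell Z = f Z - c *: g Z) ->
  derivation ell Z1 Z2 Z3 = derivation f Z1 Z2 Z3 - c *: derivation g Z1 Z2 Z3.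
Proof.
move=> ellE; rewrite /derivation !ellE curv_lin1 curv_lin2 curv_lin3.
by rewrite !scalerBr !scalerDr; apply/rowP => d; rewrite !mxE; ring.
Qed.

(** Since $R(X,Y)$ is skew for the metric, lowering an index commutes with its action. *)
Lemma cov4_curv Xs X Y : dot_cov h Rm (cov4 Rm) Xs X Y =
  form h (derivation (curv X Y) (Xs 0) (Xs 1) (Xs 2)) (Xs 3).
Proof.
rewrite /dot_cov /act_cov !big_ord_recl big_ord0 addr0.
rewrite /cov4 /subst_at /= !assoc_Rm /derivation formBl !formDl.
rewrite -![form h (curv _ _ _) _]/(Rm _ _ _ _).
have E : Rm X Y (Xs 3) (curv (Xs 0) (Xs 1) (Xs 2))
    = Rm (Xs 0) (Xs 1) (Xs 2) (curv X Y (Xs 3)) by exact: formC.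
by rewrite (Rm34 X Y) E; ring.
Qed.

(** * Consequences of the curvature condition at a point *)

Variable L : R.
Hypothesis hP : forall (Xs : 'I_3 -> 'rV[R]_n) X Y,
  dot_vec h proj (vec3 curv) Xs X Y = L *: Q_vec ric (vec3 curv) Xs X Y.
Let lam := L + (n%:R - 1)^-1.

(** The wedge part of the operator of $P$ moves to the right-hand side and changes [L] into
    [lam]. *)
Lemma derivation_curv X Y Z1 Z2 Z3 : derivation (curv X Y) Z1 Z2 Z3 =
  lam *: derivation (wedge_op ric X Y) Z1 Z2 Z3.
Proof.
have := hP (fun i : 'I_3 => nth 0 [:: Z1; Z2; Z3] i) X Y.
rewrite /dot_vec /Q_vec !act_vec3 /= (derivation_lin _ _ _ (assoc_proj X Y)).
by move=> /eqP; rewrite subr_eq -scalerDl => /eqP.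
Qed.

(** The commutator of $X\wedge_S Y$ and $R(Z_1,Z_2)$, applied to [Z] and paired with [W]. *)
Definition wedge_star X Y Z1 Z2 Z W :=
  ric Y (Z *m rho Z1 Z2) * form h X W - ric X (Z *m rho Z1 Z2) * form h Y W
  - ric Y Z * form h (X *m rho Z1 Z2) W + ric X Z * form h (Y *m rho Z1 Z2) W.

Lemma wedge_starP X Y Z1 Z2 Z W : lam != 0 ->
  wedge_star X Y Z1 Z2 Z W + wedge_star X Y Z1 Z2 W Z = 0.
Proof.
move=> lam0.
have E U V : form h (derivation (wedge_op ric X Y) Z1 Z2 U) V
    = wedge_star X Y Z1 Z2 U V
      - Rm (wedge_op ric X Y Z1) Z2 U V - Rm Z1 (wedge_op ric X Y Z2) U V.
  have cE : curv Z1 Z2 (wedge_op ric X Y U) =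
      ric Y U *: curv Z1 Z2 X - ric X U *: curv Z1 Z2 Y.
    by rewrite /wedge_op curv_lin3 !curv_rho -scalemxAl.
  apply: etrans (formBl _ _ _ _) _; rewrite !(formDl, formNl, formZl).
  rewrite cE formBl !formZl.
  by rewrite /wedge_star /Rm !curv_rho; ring.
(* Up to the factor [lam], this is the skewness of $R\cdot R$ in its last two arguments. *)
have S U V : form h (derivation (wedge_op ric X Y) Z1 Z2 U) V
    + form h (derivation (wedge_op ric X Y) Z1 Z2 V) U = 0.
  apply: (mulfI lam0); rewrite mulr0 mulrDr -!formZl -!derivation_curv.
  have := cov4_curv (fun i : 'I_4 => nth 0 [:: Z1; Z2; U; V] i) X Y.
  have := cov4_curv (fun i : 'I_4 => nth 0 [:: Z1; Z2; V; U] i) X Y.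
  rewrite /dot_cov /act_cov !big_ord_recl !big_ord0 !addr0 /=.
  rewrite /cov4 /subst_at /= => <- <-.
  by rewrite (Rm34 _ _ V U) (Rm34 _ _ V U) (Rm34 _ _ V) (Rm34 Z1 Z2 _ U); ring.
have := S Z W; rewrite !E (Rm34 _ _ W Z) (Rm34 Z1 _ W Z).
by move=> <-; ring.
Qed.

Lemma rho_ricA Z1 Z2 : (0 < n)%N -> lam != 0 ->
  ricA *m rho Z1 Z2 = (\tr ricA / n%:R) *: rho Z1 Z2.
Proof.
move=> n0 lam0; have nR : n%:R != 0 :> R by rewrite pnatr_eq0 -lt0n.
have [|E ->] := star_commute hT hU ricM_sym (rho_skew Z1 Z2).
  by move=> X Y Z W; rewrite -!ric_form; exact: wedge_starP.
by apply: (scalerI nR); rewrite E scalerA mulrC divfK.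
Qed.

Lemma ric_rho Y Z Z1 Z2 : (0 < n)%N -> lam != 0 ->
  ric Y (Z *m rho Z1 Z2) = - (\tr ricA / n%:R * form h (Y *m rho Z1 Z2) Z).
Proof.
move=> n0 lam0; have hrhoT : h *m (rho Z1 Z2)^T = - (rho Z1 Z2 *m h).
  by rewrite -rho_skew trmx_mul hT.
rewrite ric_form formMr -ricA_h -mulmxA hrhoT mulmxN mulmxA rho_ricA //.
by rewrite -scalemxAl form_mxN form_mxZ formMl.
Qed.

(** The trace-free Ricci form [B] either vanishes on the diagonal, and polarization gives [B = 0],
    or is nonzero at some [Z], and then the whole Ricci tensor vanishes. *)
Lemma ric_einstein : (0 < n)%N -> lam != 0 ->
  forall X Y, ric X Y = \tr ricA / n%:R * form h X Y.
Proof.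
move=> n0 lam0; set c := _ / _; pose B X Y := ric X Y - c * form h X Y.
have BC X Y : B X Y = B Y X by rewrite /B ricC formC.
have BD X Y Z : B (X + Y) Z = B X Z + B Y Z.
  by rewrite /B !ric_form !formDl; ring.
(* With [X = Z = W], the star identity collapses to $B(Z,Z)\,R(Z_1,Z_2,Y,Z)=0$; a contraction passes
   to Ricci. *)
have Bker Z : B Z Z != 0 -> forall U, ric U Z = 0.
  move=> BZ U; have RmZ Z1 Z2 Y : Rm Z1 Z2 Y Z = 0.
    have Z0 : form h (Z *m rho Z1 Z2) Z = 0.
      by have := Rm34 Z1 Z2 Z Z; rewrite /Rm curv_rho => E; lra.
    have := wedge_starP Z Y Z1 Z2 Z Z lam0; rewrite /wedge_star !ric_rho // Z0 -/c.
    move=> E; apply: (mulfI BZ); rewrite mulr0 /Rm curv_rho /B.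
    by move: E; lra.
  rewrite /ric (@eq_contraction _ _ _ _ (fun _ _ => 0)) => [|X Y].
    by rewrite /contraction big1 // => a _; rewrite big1 // => b _; rewrite mulr0.
  by rewrite Rm34 RmZ oppr0.
have [BZ|] := pselect (forall Z, B Z Z = 0).
  move=> X Y; apply/eqP; rewrite -subr_eq0 -/(B X Y).
  have := BZ (X + Y); rewrite BD !(BC _ (X + Y)) !BD !BZ (BC Y X) => E.
  by apply/eqP; lra.
move=> /existsNP[Z /eqP BZ].
(* If [B V V = 0], then [B] is nonzero on [Z + V] or on [Z - V], since the    *)
(* sum of the two values is [2 B Z Z].                                        *)
have ric0 V U : ric U V = 0.
  have [BV|/Bker -> //] := eqVneq (B V V) 0.
  have ric_lin c' : B (Z + c' *: V) (Z + c' *: V) != 0 -> c' * ric U V = 0.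
    by move=> /Bker /(_ U); rewrite !ric_form formDr formZr -ric_form Bker // add0r.
  have BE c' : B (Z + c' *: V) (Z + c' *: V) = B Z Z + 2 * c' * B Z V.
    rewrite BD !(BC _ (Z + _)) !BD (BC (c' *: V) Z).
    have BZl x y : B (c' *: x) y = c' * B x y by rewrite /B !ric_form !formZl; ring.
    by rewrite (BC Z) !BZl (BC _ (c' *: V)) BZl BV (BC V Z); ring.
  have [E1|/ric_lin] := eqVneq (B (Z + 1 *: V) (Z + 1 *: V)) 0; last by rewrite mul1r.
  have /ric_lin : B (Z + (-1) *: V) (Z + (-1) *: V) != 0.
    by apply: contra_neq BZ; move: E1; rewrite !BE; lra.
  by rewrite mulN1r => /eqP; rewrite oppr_eq0 => /eqP.
have ricM0 : ricM = 0 by apply: form_inj => X Y; rewrite -ric_form ric0 form_mx0.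
by move=> X Y; rewrite ric0 /c /ricA ricM0 mul0mx mxtrace0 !mul0r.
Qed.

(** This is $Q(S,S)=0$. *)
Lemma ric_wedge X Y Z1 Z2 :
  ric (wedge_op ric X Y Z1) Z2 + ric Z1 (wedge_op ric X Y Z2) = 0.
Proof.
by rewrite (ricC Z1) /wedge_op !ric_form !formBl !formZl -!ric_form; ring.
Qed.

(** For [lam = 0], the derivation identity is traced over its first argument, and the commutator of
    [tau Z1 Z2] and [rho X Y] has trace zero. Otherwise $S$ is a multiple of $g$, for which
    curvature operators are skew. *)
Lemma ric_semisymmetric X Y Z1 Z2 : (0 < n)%N ->
  ric (curv X Y Z1) Z2 + ric Z1 (curv X Y Z2) = 0.
Proof.
move=> n0; have [lam0|lam0] := eqVneq lam 0; last first.
  rewrite !ric_einstein // -mulrDr (formC _ Z1) // -!/(Rm _ _ _ _) Rm34 addNr.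
  by rewrite mulr0.
have D W : W *m (tau Z1 Z2 *m rho X Y) = W *m (rho X Y *m tau Z1 Z2
    + tau (curv X Y Z1) Z2 + tau Z1 (curv X Y Z2)).
  have := derivation_curv X Y W Z1 Z2; rewrite lam0 scale0r /derivation.
  move=> /eqP; rewrite subr_eq0 => /eqP; rewrite !curv_tau !mulmxDr.
  by rewrite -!curv_tau (curv_rho X Y (curv _ _ _)) (curv_rho X Y W) !curv_tau !mulmxA.
have E : tau Z1 Z2 *m rho X Y = rho X Y *m tau Z1 Z2
    + tau (curv X Y Z1) Z2 + tau Z1 (curv X Y Z2).
  by apply/row_matrixP => a; rewrite !rowE D.
have := congr1 mxtrace E; rewrite !mxtraceD -!ricE mxtrace_mulC -addrA.
by move=> /eqP; rewrite -subr_eq0 opprD addNKr oppr_eq0 => /eqP.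
Qed.

(** By semisymmetry, $R(X,Y,Z,AW)=R(X,Y,AZ,W)$ for the Ricci operator $A$, and the contraction of
    the right-hand side is $S(Y,AZ)$. *)
Lemma contraction_ricA Y Z : (0 < n)%N ->
  contraction h (fun X W => Rm X Y Z (W *m ricA)) = form h (Y *m ricA *m ricA) Z.
Proof.
move=> n0; have ricl U V : ric U V = form h U (V *m ricA).
  by rewrite ricC formC // formMl ricA_h ric_form.
rewrite (@eq_contraction _ _ _ _ (fun X W => Rm X Y (Z *m ricA) W)) => [|X W].
  have adj U V : form h U (V *m ricA) = form h (U *m ricA) V.
    by rewrite -ricl ricC ricl formC.
  by rewrite -/(ric Y (Z *m ricA)) ricl !adj.
have := ric_semisymmetric X Y Z W n0; rewrite (ricC Z) !ricl => E.
rewrite (Rm34 X Y (Z *m ricA)); apply/eqP; rewrite -subr_eq0 opprK; apply/eqP.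
exact: E.
Qed.

End AlgebraicCurvature.

(** * Curvature of a semi-Riemannian manifold at a point *)

Section PointwiseCurvature.
Variables (R : realType) (n : nat) (M : smooth_manifold R n).
Variables (g : semi_riemannian_metric M) (i : atlas M) (p : M).
Hypothesis ip : dom i p.

(** The tensors at [p] are convertible to the algebraic ones with these coefficients, so the
    preceding results apply directly. *)
Let K a b c d := curvature_coef (gmat g i) a b c d (chart i p).

Lemma chart_in_image : (chart i @` dom i) (chart i p).
Proof. by exists p. Qed.

Lemma gram_sym : (gram g i p)^T = gram g i p.
Proof. exact/gmat_sym/chart_in_image. Qed.

Lemma gram_unit : gram g i p \in unitmx.
Proof. exact/gmat_nondegenerate/chart_in_image. Qed.

Lemma chart_curvatureC a b c d : K a b c d = - K b a c d.
Proof. exact: curvature_coefC. Qed.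

Lemma chart_curvature_bianchi a b c d : K a b c d + K b c a d + K c a b d = 0.
Proof.
apply: (curvature_coef_bianchi (@chart_image_open _ _ M i)); last exact: chart_in_image.
exact: gmat_sym.
Qed.

Lemma chart_curvature_skew a b c d :
  \sum_e K a b c e * gram g i p e d = - \sum_e K a b d e * gram g i p e c.
Proof.
apply: (curvature_coef_skew (@chart_image_open _ _ M i)); last exact: chart_in_image.
- exact: gmat_sym.
- exact: gmat_nondegenerate.
- exact: gmat_smooth.
Qed.


Lemma scalK : scal g i p = \tr (ricA (gram g i p) K).
Proof. exact: (scalE K gram_sym gram_unit). Qed.

Lemma RicOpE X : RicOp g i p X = X *m ricA (gram g i p) K.
Proof. exact: (ricopE K gram_sym gram_unit). Qed.

Lemma assoc_Riem X Y Z : assoc13 (gram g i p) (Riem g i p) X Y Z = Riem13 g i p X Y Z.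
Proof. exact: (assoc_Rm K gram_unit). Qed.

Lemma assoc_Proj X Y Z : assoc13 (gram g i p) (Proj g i p) X Y Z =
  Riem13 g i p X Y Z - (n%:R - 1)^-1 *: wedge_op (Ric g i p) X Y Z.
Proof. exact: (assoc_proj K gram_unit). Qed.

Variable L : R.
Hypothesis n0 : (0 < n)%N.
Hypothesis hP : forall (Xs : 'I_3 -> 'rV[R]_n) (X Y : 'rV[R]_n),
  dot_vec (gram g i p) (Proj g i p) (vec3 (Riem13 g i p)) Xs X Y
  = L *: Q_vec (Ric g i p) (vec3 (Riem13 g i p)) Xs X Y.

Lemma Riem_semisymmetric Xs X Y : L + (n%:R - 1)^-1 = 0 ->
  dot_cov (gram g i p) (Riem g i p) (cov4 (Riem g i p)) Xs X Y = 0.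
Proof.
move=> lam0; apply: etrans (cov4_curv gram_sym gram_unit chart_curvature_skew Xs X Y) _.
rewrite (derivation_curv gram_unit chart_curvatureC hP) lam0.
by rewrite formZl mul0r.
Qed.

Lemma Ric_semisymmetric Xs X Y :
  dot_cov (gram g i p) (Riem g i p) (cov2 (Ric g i p)) Xs X Y = 0.
Proof.
rewrite /dot_cov /act_cov !big_ord_recl big_ord0 addr0 /cov2 /subst_at /=.
rewrite !assoc_Riem; apply/eqP; rewrite oppr_eq0; apply/eqP.
exact: (ric_semisymmetric gram_sym gram_unit chart_curvatureC chart_curvature_bianchi
  chart_curvature_skew hP).
Qed.

Lemma Proj_Ric Xs X Y :
  dot_cov (gram g i p) (Proj g i p) (cov2 (Ric g i p)) Xs X Y = 0.
Proof.
have RicE U V : Ric g i p U V = form (ricM K) U V := ric_form K gram_sym gram_unit U V.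
rewrite -(Ric_semisymmetric Xs X Y).
rewrite /dot_cov /act_cov !big_ord_recl !big_ord0 !addr0 /cov2 /subst_at /=.
rewrite !assoc_Riem !assoc_Proj; congr (- _).
rewrite !RicE formBl formBr formZl formZr -!RicE.
have W : Ric g i p (wedge_op (Ric g i p) X Y (Xs 0)) (Xs 1) +
    Ric g i p (Xs 0) (wedge_op (Ric g i p) X Y (Xs 1)) = 0.
  exact: (ric_wedge gram_sym gram_unit chart_curvatureC chart_curvature_bianchi
    chart_curvature_skew).
by rewrite addrACA -opprD -mulrDr W mulr0 subr0.
Qed.

Lemma Etens_Ric2 X Y : Etens g i p X Y = Ric2 g i p X Y.
Proof.
rewrite /Ric2 !RicOpE.
have := contraction_ricA gram_sym gram_unit chart_curvatureC chart_curvature_bianchi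
  chart_curvature_skew hP X Y n0.
rewrite /metric_at => <-; apply: eq_contraction => X1 X2.
by rewrite RicOpE.
Qed.

Hypothesis lam0 : L + (n%:R - 1)^-1 != 0.

Lemma einstein_point : einstein_at g i p.
Proof.
move=> X Y; rewrite scalK.
exact: (ric_einstein gram_sym gram_unit chart_curvatureC chart_curvature_bianchi
  chart_curvature_skew hP n0 lam0).
Qed.

Lemma RicOp_einstein X : RicOp g i p X = scal g i p / n%:R *: X.
Proof.
by apply: (sharp_metric gram_unit) => Y; rewrite einstein_point formZl.
Qed.

Lemma Ric2_einstein X Y :
  Ric2 g i p X Y = (scal g i p / n%:R) ^+ 2 * metric_at g i p X Y.
Proof. by rewrite /Ric2 !RicOp_einstein /metric_at !formZl mulrA. Qed.

Lemma scal2_einstein : scal2 g i p = scal g i p ^+ 2 / n%:R.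
Proof.
have nR : n%:R != 0 :> R by rewrite pnatr_eq0 -lt0n.
rewrite /scal2.
have -> : lin1_mx (RicOp g i p \o RicOp g i p) = ((scal g i p / n%:R) ^+ 2)%:M.
  apply/matrixP => a b; rewrite [LHS]mxE /= !RicOp_einstein !mxE.
  by rewrite eqxx eq_sym mulrA -expr2 mulr_natr.
by rewrite mxtrace_scalar -mulr_natr; field.
Qed.

(** The Ricci operator is a multiple of the identity, which every linear endomorphism annihilates;
    both sides are zero. *)
Lemma Proj_RicOp Xs X Y :
  dot_vec (gram g i p) (Proj g i p) (vec1 (RicOp g i p)) Xs X Y
  = L *: Q_vec (metric_at g i p) (vec1 (RicOp g i p)) Xs X Y.
Proof.
rewrite /dot_vec /Q_vec /act_vec !big_ord_recl !big_ord0 !addr0 /vec1 /subst_at /=.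
rewrite !RicOp_einstein !assoc_Proj /wedge_op !einstein_point.
have RiemZ c Z : Riem13 g i p X Y (c *: Z) = c *: Riem13 g i p X Y Z.
  have E U : Riem13 g i p X Y U = U *m rho K X Y := curv_rho K X Y U.
  by rewrite !E scalemxAl.
rewrite RiemZ /metric_at !formZr.
move: (Riem13 _ _ _ _ _ _) (form _ Y _) (form _ X _) (_ / _) => Z a b c.
by apply/rowP => d; rewrite !mxE; ring.
Qed.

(** Once the scalar is taken out, reversing the order of the four arguments of $R$ matches the terms
    in cancelling pairs. *)
Lemma Riem_RicOp_sym X1 X2 X Y :
  Riem g i p Y X1 X2 (RicOp g i p X) + Riem g i p Y X2 X1 (RicOp g i p X)
  - Riem g i p X X1 X2 (RicOp g i p Y) - Riem g i p X X2 X1 (RicOp g i p Y) = 0.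
Proof.
have pair U1 U2 U3 U4 : Riem g i p U1 U2 U3 U4 = Riem g i p U3 U4 U1 U2.
  exact: (Rm_pair chart_curvatureC chart_curvature_bianchi chart_curvature_skew).
have swap U1 U2 U3 U4 : Riem g i p U1 U2 U3 U4 = Riem g i p U4 U3 U2 U1.
  rewrite pair; apply: etrans (Rm12 _ chart_curvatureC _ _ _ _) _.
  by rewrite (Rm34 chart_curvature_skew) opprK.
have RiemZ c U1 U2 U3 U4 : Riem g i p U1 U2 U3 (c *: U4) = c * Riem g i p U1 U2 U3 U4.
  by rewrite /Riem /metric_at formZr.
rewrite !RicOp_einstein !RiemZ (swap Y X1) (swap Y X2); ring.
Qed.

End PointwiseCurvature.

Theorem theorem4p14 (R : realType) (n : nat) (hn : (3 <= n)%N)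
    (M : smooth_manifold R n) (hM : connected [set: M])
    (g : semi_riemannian_metric M) (L : M -> R) (hL : smooth_fun L)
    (hP : forall (i : atlas M) (p : M), dom i p ->
       forall (Xs : 'I_3 -> 'rV[R]_n) (X Y : 'rV[R]_n),
         dot_vec (gram g i p) (Proj g i p) (vec3 (Riem13 g i p)) Xs X Y
         = L p *: Q_vec (Ric g i p) (vec3 (Riem13 g i p)) Xs X Y) :
  (* (i) *)
  (forall (i : atlas M) (p : M), dom i p -> L p + (n%:R - 1)^-1 = 0 ->
     forall (Xs : 'I_4 -> 'rV[R]_n) (X Y : 'rV[R]_n),
       dot_cov (gram g i p) (Riem g i p) (cov4 (Riem g i p)) Xs X Y = 0)
  /\
  (* (ii) *)
  (forall (i : atlas M) (p : M), dom i p ->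
     (forall (Xs : 'I_2 -> 'rV[R]_n) (X Y : 'rV[R]_n),
        dot_cov (gram g i p) (Proj g i p) (cov2 (Ric g i p)) Xs X Y = 0 /\
        dot_cov (gram g i p) (Riem g i p) (cov2 (Ric g i p)) Xs X Y = 0) /\
     (forall X Y : 'rV[R]_n, Etens g i p X Y = Ric2 g i p X Y))
  /\
  (* (iii) *)
  (forall (i : atlas M) (p : M), dom i p -> L p + (n%:R - 1)^-1 != 0 ->
     (forall X Y : 'rV[R]_n,
        n%:R ^+ 2 * Ric2 g i p X Y - 2 * n%:R * scal g i p * Ric g i p X Y
        + scal g i p ^+ 2 * metric_at g i p X Y = 0) /\
     scal2 g i p = scal g i p ^+ 2 / n%:R)
  /\
  (* (iv), still in the case L + 1/(n-1) <> 0 *)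
  ((forall (i : atlas M) (p : M), dom i p -> L p + (n%:R - 1)^-1 != 0 ->
      (forall X1 X2 X3 X4 : 'rV[R]_n,
         kulkarni_nomizu (Ric g i p) (Ric g i p) X1 X2 X3 X4
         = kulkarni_nomizu (metric_at g i p) (Ric2 g i p) X1 X2 X3 X4) /\
      (forall X Y : 'rV[R]_n,
         Ric2 g i p X Y = scal g i p / n%:R * Ric g i p X Y /\
         Ric2 g i p X Y = scal2 g i p / n%:R * metric_at g i p X Y) /\
      (scal g i p != 0 -> einstein_at g i p)) /\
   ((forall p : M, L p + (n%:R - 1)^-1 != 0) ->
    (exists (i : atlas M) (p : M), dom i p /\ scal g i p != 0) ->
    einstein g))
  /\
  (* (v) *)
  (forall (i : atlas M) (p : M), dom i p -> L p + (n%:R - 1)^-1 != 0 ->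
     ((forall (Xs : 'I_1 -> 'rV[R]_n) (X Y : 'rV[R]_n),
         dot_vec (gram g i p) (Proj g i p) (vec1 (RicOp g i p)) Xs X Y
         = L p *: Q_vec (metric_at g i p) (vec1 (RicOp g i p)) Xs X Y)
      <->
      (forall X1 X2 X Y : 'rV[R]_n,
         Riem g i p Y X1 X2 (RicOp g i p X) + Riem g i p Y X2 X1 (RicOp g i p X)
         - Riem g i p X X1 X2 (RicOp g i p Y)
         - Riem g i p X X2 X1 (RicOp g i p Y) = 0))).
Proof.

have n0 : (0 < n)%N by apply: leq_trans hn.
have nR : n%:R != 0 :> R by rewrite pnatr_eq0 -lt0n.
have einst i p (ip : dom i p) := einstein_point ip n0 (hP i p ip).
have Ric2E i p (ip : dom i p) := Ric2_einstein ip n0 (hP i p ip).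
have scal2E i p (ip : dom i p) := scal2_einstein ip n0 (hP i p ip).
split; [|split; [|split; [|split; [split|]]]].
- by move=> i p ip lam0 Xs X Y; exact: (Riem_semisymmetric ip (hP i p ip)).
- move=> i p ip; split=> [Xs X Y|X Y]; last exact: (Etens_Ric2 ip n0 (hP i p ip)).
  by split; [exact: (Proj_Ric ip n0 (hP i p ip))|exact: (Ric_semisymmetric ip n0 (hP i p ip))].
- move=> i p ip lam0; split=> [X Y|]; last exact: scal2E.
  by rewrite Ric2E // einst //; field.
- move=> i p ip lam0; split=> [X1 X2 X3 X4|].
    by rewrite /kulkarni_nomizu !Ric2E // !einst //; ring.
  split=> [X Y|_]; last exact: einst.
  rewrite Ric2E // einst // scal2E //.
  by split; [ring|field].
- by move=> lam0 _ i p ip; exact: einst.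
(* The Einstein property at [p] yields each of the two conditions. *)
- move=> i p ip lam0; split=> _ *; first exact: (Riem_RicOp_sym ip n0 (hP i p ip)).
  exact: (Proj_RicOp ip n0 (hP i p ip)).
Qed.
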